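(* Let $h,\tilde h$ be $S$-good functions for all $S<T$ with $\mathcal{A}h=0$ (and $D^{\tilde h}_t>0$ for $t<T$), and let $\mathbb{P}^\star,\mathbb{P}^\circ$ be the laws induced by $h$ and $\tilde h$. Fix $t_0\in[0,T)$. Suppose there exist a positive continuous function $\kappa\colon[t_0,T)\to(0,\infty)$ and, for each $t\in[t_0,T)$, a family of $\mathcal{F}_t$-measurable events $\{A_k(t)\}_{k}$ (with $A_k(T):=\bigcap_{t<T}A_k(t)$ and $A(t):=\bigcup_kA_k(t)$ for $t\in[t_0,T]$) such that: (a) for all $k$ and $t_0\le s\le t\le T$: $A_k(t)\subseteq A_{k+1}(t)$ and $A_k(t)\subseteq A_k(s)$; (b) the transition kernel of $X$ admits under $\mathbb{P}$ a transition density $p$ with respect to a dominating measure $\nu$, i.e. $\mathbb{P}(X_t\in A\mid X_s=x)=\int_A p(s,x;t,y)\,\mathrm{d}\nu(y)$ for $0\le s\le t\le T$, $A\in\mathcal{B}$, $x\in\mathcal{S}$; moreover, with $$h^\sharp(t;s,x)=\int\kappa(t)\tilde h(t,y)p(s,x;t,y)\,\mathrm{d}\nu(y),$$ one has $\lim_{t\uparrow T}h^\sharp(t;s,x)=h(s,x)$ for all $s<T$ and $x\in\mathcal{S}$; (c) for all $t_0\le s<t<T$, the random variable $h^\sharp(t;s,X_s)$ is $\mathbb{P}$-almost surely bounded; (d) $\displaystyle\lim_{k\to\infty}\lim_{t\uparrow T}\mathbb{E}^\star_t\Big(\frac{\tilde h(t,X_t)}{h(t,X_t)}\kappa(t)\mathbf{1}_{A_k(t)}\Big)=\mathbb{P}^\star_T(A(T))$;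 (e) for all fixed $k$, $\Psi_t(X)\kappa(t)\mathbf{1}_{A_k(t)}$ is $\mathbb{P}^\circ$-almost surely uniformly bounded in $t$. Let $\Psi_T^\kappa(X)$ be the random variable with $\Psi_T^\kappa(X)\mathbf{1}_{A_k(T)}=\lim_{t\uparrow T}\Psi_t(X)\kappa(t)\mathbf{1}_{A_k(t)}$ ($\mathbb{P}^\circ$-almost surely) for all $k$. Then for any measurable function $f$ $$\mathbb{E}^\star_T\big(f(X)\mathbf{1}_{A(T)}\big)=\mathbb{E}^\circ_T\Big(f(X)\frac{\tilde h(0,x_0)}{h(0,x_0)}\Psi_T^\kappa(X)\mathbf{1}_{A(T)}\Big).$$ In particular, if $\mathbb{P}^\circ_T(A(T))=1$, the measures $\mathbb{P}^\star_T$ and $\mathbb{P}^\circ_T$ are equivalent with $$\frac{\mathrm{d}\mathbb{P}^\star_T}{\mathrm{d}\mathbb{P}^\circ_T}(X)=\frac{\tilde h(0,x_0)}{h(0,x_0)}\Psi_T^\kappa(X).$$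
   Context: Let $T>0$ and let $X=(X_t)_{t\in[0,T]}$ be a Markov process on a Polish space $\mathcal{S}$ with $\sigma$-algebra $\mathcal{B}$, defined on a probability space with measure $\mathbb{P}$; $\mathcal{F}_t=\sigma(X_s:s\le t)$. Fix $x_0\in\mathcal{S}$; all probabilities and expectations are conditional on $X_0=x_0$. $\mathbb{P}_t$ is the restriction of $\mathbb{P}$ to $\mathcal{F}_t$ and $\mathbb{E}_t$ its expectation. $X$ is generated by operators $\mathcal{L}=(\mathcal{L}_t)_{t\in[0,T]}$ with common domain $\mathcal{D}(\mathcal{L})$, i.e. $f(X_t)-f(x_0)-\int_0^t\mathcal{L}_sf(X_s)\,\mathrm{d}s$ is a local martingale for $f\in\mathcal{D}(\mathcal{L})$. The space-time generator is $\mathcal{A}f(t,x)=\frac{\partial f}{\partial t}(t,x)+\mathcal{L}_tf(t,x)$ with domain $\mathcal{D}(\mathcal{A})$; for $g\in\mathcal{D}(\mathcal{A})$ the process $g(t,X_t)-g(0,x_0)-\int_0^t\mathcal{A}g(s,X_s)\,\mathrm{d}s$ is a local martingale. For $S\le T$, $h\in\mathcal{D}(\mathcal{A})$ is called $S$-good if $h$ is positive and $$D^h_t=\frac{h(t,X_t)}{h(0,x_0)}\exp\Big(-\int_0^t\frac{\mathcal{A}h}{h}(s,X_s)\,\mathrm{d}s\Big),\quad 0\le t\le S,$$ is a martingale with respect to $(\mathcal{F}_t)_{t\in[0,S]}$. The conditioned measure induced by $h$ is $\mathrm{d}\mathbb{P}^\star_t=D^h_t\,\mathrm{d}\mathbb{P}_t$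 and the guided measure induced by $\tilde h$ is $\mathrm{d}\mathbb{P}^\circ_t=D^{\tilde h}_t\,\mathrm{d}\mathbb{P}_t$ ($t<T$), with expectations $\mathbb{E}^\star_t,\mathbb{E}^\circ_t$. $\mathbb{P}^\star_T$, $\mathbb{P}^\circ_T$ denote the probability measures on $\sigma(\bigcup_{t<T}\mathcal{F}_t)$ whose restrictions to $\mathcal{F}_t$ are $\mathbb{P}^\star_t$, $\mathbb{P}^\circ_t$ for all $t<T$, with expectations $\mathbb{E}^\star_T,\mathbb{E}^\circ_T$, and measurable functions $f$ of $X$ are measurable with respect to this $\sigma$-algebra. Finally $$\Psi_t(X)=\exp\Big(\int_0^t\frac{\mathcal{A}\tilde h}{\tilde h}(s,X_s)\,\mathrm{d}s\Big).$$
   Formalization: The closing claim is false from P°_T(A(T))=1 alone. The formal statement also assumes P*_T(A(T))=1 to get P*_T absolutely continuous w.r.t. P°_T with the stated density, and Ψ_T^κ>0 P°-a.s. for the converse; both conditions are necessary. *)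

(* Defs.v *)
From HB Require Import structures.
From mathcomp Require Import all_boot all_order all_algebra.
From mathcomp Require Import all_classical all_reals all_analysis.

Set Implicit Arguments.
Unset Strict Implicit.
Unset Printing Implicit Defensive.

Import Order.TTheory GRing.Theory Num.Theory.
Import numFieldNormedType.Exports.

Local Open Scope classical_set_scope.
Local Open Scope ring_scope.

Notation borel S := (g_sigma_algebraType (@open S)).

(* separable and completely metrizable; no metric is part of the structure *)
Definition polish_space (R : realType) (S : topologicalType) : Prop :=
  (exists2 D : set S, countable D & dense D) /\
  exists dist : S -> S -> R,
    [/\ forall x y, 0 <= dist x y /\ (dist x y = 0 <-> x = y),
        forall x y, dist x y = dist y x,
        forall x y z, dist x z <= dist x y + dist y z,
        forall x (U : set S), nbhs x U <->
          exists2 e : R, 0 < e & [set y | dist x y < e] `<=` U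
      & forall u : nat -> S,
          (forall e : R, 0 < e -> exists N : nat, forall m n : nat,
            (N <= m)%N -> (N <= n)%N -> dist (u m) (u n) < e) ->
          exists l : S, u @ \oo --> l].

Section martingales.
Context (R : realType) (d : measure_display) (Omega : measurableType d).
Variable P : probability Omega R.

Definition martingale (F : R -> set (set Omega)) (I : set R)
    (M : R -> Omega -> R) : Prop :=
  [/\ forall t, I t -> forall U : set R, measurable U -> F t (M t @^-1` U),
      forall t, I t -> P.-integrable [set: Omega] (EFin \o M t)
    & forall s t, I s -> I t -> s <= t -> forall B, F s B ->
        (\int[P]_(w in B) (M t w)%:E = \int[P]_(w in B) (M s w)%:E)%E].

Definition stopping_time (F : R -> set (set Omega)) (T : R)
    (tau : Omega -> R) : Prop :=
  (forall w, 0 <= tau w) /\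
  forall t, 0 <= t <= T -> F t [set w | tau w <= t].

(* The index set is the compact [0, T], so a localizing sequence has to reach
   T after finitely many steps, almost surely. *)
Definition local_martingale (F : R -> set (set Omega)) (T : R)
    (M : R -> Omega -> R) : Prop :=
  exists tau : nat -> Omega -> R,
    [/\ forall n, stopping_time F T (tau n),
        forall n w, tau n w <= tau n.+1 w,
        {ae P, forall w, exists n, T <= tau n w}
      & forall n, martingale F `[0, T]
          (fun t w => M (Num.min t (tau n w)) w)].

End martingales.

Section processes.
Context (R : realType) (d : measure_display) (Omega : measurableType d).
Context (S : ptopologicalType).
Implicit Types (X : R -> Omega -> S) (P : probability Omega R) (T : R).

Definition natural_filtration X (t : R) : set (set Omega) :=
  <<s \bigcup_(s in `[0, t])
        preimage_set_system [set: Omega] (X s) (@measurable _ (borel S)) >>.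

(* <<s pre_terminal X T >> is the sigma-algebra generated by the union of the
   natural_filtration X t over t < T *)
Definition pre_terminal X T : set (set Omega) :=
  \bigcup_(t in `[0, T[) natural_filtration X t.

(* Markov property with respect to the natural filtration: K s t is a regular
   version of the conditional law of X t given the past of X up to s *)
Definition markov_process P T X
    (K : R -> R -> R.-pker (borel S) ~> (borel S)) : Prop :=
  (forall t, 0 <= t <= T -> measurable_fun [set: Omega] (X t : _ -> borel S)) /\
  forall s t, 0 <= s -> s <= t -> t <= T ->
    forall (B : set Omega) (C : set (borel S)),
      natural_filtration X s B -> measurable C ->
      P (B `&` X t @^-1` C) = (\int[P]_(w in B) K s t (X s w) C)%E.

(* The case s = t is left out: there the kernel is a Dirac mass, which has no
   density with respect to a diffuse nu. *)
Definition transition_density T (K : R -> R -> R.-pker (borel S) ~> (borel S))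
    (nu : {measure set (borel S) -> \bar R}) (p : R -> S -> R -> S -> R) :=
  forall s t x, 0 <= s -> s < t -> t <= T ->
    [/\ forall y, 0 <= p s x t y,
        measurable_fun [set: borel S] (p s x t)
      & forall C : set (borel S), measurable C ->
          K s t x C = (\int[nu]_(y in C) (p s x t y)%:E)%E].

Section generator.
Variables (L : R -> (S -> R) -> (S -> R)).

Definition space_time_generator (g : R -> S -> R) (t : R) (x : S) : R :=
  derive1 (fun u => g u x) t + L t (g t) x.

Local Notation A := space_time_generator.

Definition generated_by P T X (x0 : S) (DL : set (S -> R)) : Prop :=
  forall f, DL f ->
    [/\ measurable_fun [set: borel S] f,
        {ae P, forall w, lebesgue_measure.-integrable `[0, T]
          (fun s => (L s f (X s w))%:E)}
      & local_martingale P (natural_filtration X) T (fun t w =>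
          f (X t w) - f x0
          - \int[lebesgue_measure]_(s in `[0, t]) L s f (X s w))].

(* The time derivative is two-sided, hence only asked for at 0 < t < T; the end
   points do not contribute to the time integrals. *)
Definition space_time_generated_by P T X (x0 : S) (DL : set (S -> R))
    (DA : set (R -> S -> R)) : Prop :=
  forall g, DA g ->
    [/\ forall t, 0 < t < T ->
          DL (g t) /\ forall x, derivable (fun u => g u x) t 1,
        {ae P, forall w, lebesgue_measure.-integrable `[0, T]
          (fun s => (A g s (X s w))%:E)}
      & local_martingale P (natural_filtration X) T (fun t w =>
          g t (X t w) - g 0 x0
          - \int[lebesgue_measure]_(s in `[0, t]) A g s (X s w))].

Definition log_weight X (h : R -> S -> R) (t : R) (w : Omega) : R :=
  \int[lebesgue_measure]_(s in `[0, t]) (A h s (X s w) / h s (X s w)).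

Definition Dproc X (x0 : S) (h : R -> S -> R) (t : R) (w : Omega) : R :=
  h t (X t w) / h 0 x0 * expR (- log_weight X h t w).

Definition Psi X (h : R -> S -> R) (t : R) (w : Omega) : R :=
  expR (log_weight X h t w).

(* The integrability clause says that the time integral in Dproc exists. *)
Definition good P X (x0 : S) (DA : set (R -> S -> R)) (u : R)
    (h : R -> S -> R) : Prop :=
  [/\ DA h,
      forall t x, 0 <= t <= u -> 0 < h t x,
      {ae P, forall w, lebesgue_measure.-integrable `[0, u]
        (fun s => (A h s (X s w) / h s (X s w))%:E)}
    & martingale P (natural_filtration X) `[0, u] (Dproc X x0 h)].

(* expectation of an F_t-measurable Y under the measure Dproc_t dP_t *)
Definition induced_expectation P X (x0 : S) (h : R -> S -> R) (t : R)
    (Y : Omega -> R) : \bar R :=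
  (\int[P]_w (Y w * Dproc X x0 h t w)%:E)%E.

(* Q is the measure on sigma(U_(t < T) F_t) whose restriction to each F_t is
   Dproc_t dP_t *)
Definition is_induced_law P T X (x0 : S) (h : R -> S -> R)
    (Q : probability (g_sigma_algebraType (pre_terminal X T)) R) : Prop :=
  forall t, 0 <= t < T -> forall B, natural_filtration X t B ->
    Q B = (\int[P]_(w in B) (Dproc X x0 h t w)%:E)%E.

End generator.

Definition hsharp (nu : {measure set (borel S) -> \bar R})
    (p : R -> S -> R -> S -> R) (kappa : R -> R) (ht : R -> S -> R)
    (t s : R) (x : S) : \bar R :=
  (\int[nu]_y (kappa t * ht t y * p s x t y)%:E)%E.

(* extends a family given on [t0, T[ to the time T *)
Definition closed_family (t0 T : R) (A : nat -> R -> set Omega)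
    (k : nat) (t : R) : set Omega :=
  if t < T then A k t else \bigcap_(s in `[t0, T[) A k s.

Definition union_family (t0 T : R) (A : nat -> R -> set Omega)
    (t : R) : set Omega := \bigcup_k closed_family t0 T A k t.

End processes.

(* Main.v *)
Require Import Defs.
From HB Require Import structures.
From mathcomp Require Import all_boot all_order all_algebra.
From mathcomp Require Import all_classical all_reals all_analysis.
From mathcomp Require Import measurable_realfun ring.

(** Write [V t = kappa t * ht t (X t)].  Both changes of measure turn the
    quantities of interest into [P]-integrals of [V]: since [h] is harmonic,
    [Dproc h] at [t] is [h t (X t) / h 0 x0], and [Dproc ht * Psi] at [t] is
    [ht t (X t) / ht 0 x0], so that for [B] in [F_t]

      [ht 0 x0 * Ecirc (Psi t * kappa t; B and A k t) = E (V t; B and A k t)]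

    ([integral_Pcirc]), and the expectation in [hyp_d] is the same
    integral over [A k t], divided by [h 0 x0].

    The Markov property identifies [hsharp t s (X s)] with the conditional
    expectation of [V t] given [F_s] ([integral_hsharp]).  It converges to
    [h s (X s)], the density of [Pstar] on [F_s] up to the factor [h 0 x0], and
    the case [s = 0] says that the total mass [E (V t)] converges to [h 0 x0]
    ([cvg_mass]).  Fatou's lemma therefore gives
    [h 0 x0 * Pstar C <= liminf E (V t; C)] for [C] in [F_s]
    ([Pstar_le_limn_einf]).  Applied to the complement of [B and A k s] and
    subtracted from the total mass, it bounds from above the mass that the
    integrals over the smaller events [B and A k t] can retain
    ([guided_le_conditioned_before]).  These integrals converge by the
    uniform bound [hyp_e] and dominated convergence ([cvg_guided_weight]).
    Letting first [s] increase to [T] and then [k] to infinity,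

      [Ecirc (ratio; B and A T) <= Pstar (B and A T)]

    for all [B] in the union of the [F_s], where
    [ratio = ht 0 x0 / h 0 x0 * PsiT].  Hypothesis [hyp_d] states exactly
    that nothing is lost when [B] is the whole space.  As the inequality holds for
    [B] and for its complement, it is an equality; the union of the [F_s] is
    stable under intersection, so that the equality extends to the
    sigma-algebra that it generates ([conditioned_eq_guided]).  The formula for
    functions and the Radon-Nikodym statement follow from this identity of
    measures. *)

Set Implicit Arguments.
Unset Strict Implicit.
Unset Printing Implicit Defensive.

Import Order.TTheory GRing.Theory Num.Theory.
Import numFieldNormedType.Exports.

Local Open Scope classical_set_scope.
Local Open Scope ring_scope.

(** * Sequences that approach an end point, and inferior limits *)

Section real_sequences.
Context (R : realType).

(** The shift by two keeps the sequence away from [a] as well, so that all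
    its terms are interior points. *)
Definition approach (a b : R) (n : nat) : R := b - (b - a) / n.+2%:R.

Variables (a b : R).
Hypothesis ab : a < b.

Lemma approach_itv n : a < approach a b n < b.
Proof.
have ba : 0 < b - a by rewrite subr_gt0.
rewrite /approach; apply/andP; split; last by rewrite gtrBl divr_gt0.
by rewrite ltrBrDr -ltrBrDl ltr_pdivrMr// ltr_pMr// ltr1n.
Qed.

Lemma approach_nd m n : (m <= n)%N -> approach a b m <= approach a b n.
Proof.
have ba : 0 < b - a by rewrite subr_gt0.
move=> mn; rewrite /approach lerD2l lerN2 ler_pM2l// lef_pV2 ?posrE//.
by rewrite ler_nat.
Qed.

Lemma cvg_approach : approach a b @ \oo --> b^'-.
Proof.
have cvgb : approach a b n @[n --> \oo] --> b.
  rewrite -[X in _ --> X](subr0 b); apply: cvgB; first exact: cvg_cst.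
  rewrite -(mulr0 (b - a)); apply: cvgM; first exact: cvg_cst.
  by have := @cvg_harmonic R; rewrite -cvg_shiftS.
move=> U [e /= e0 eU].
have /cvgrPdist_lt /(_ _ e0) := cvgb.
apply: filterS => n nb; apply: eU => //.
by have /andP[] := approach_itv n.
Qed.

Lemma near_approach s : s < b -> \forall n \near \oo, s < approach a b n.
Proof.
by move=> sb; exact: (cvg_approach (nbhs_left_gt sb)).
Qed.

Lemma limn_einf_le_cvg (x y : (\bar R)^nat) (l : \bar R) :
  (\forall n \near \oo, x n <= y n)%E -> y @ \oo --> l ->
  (limn_einf x <= l)%E.
Proof.
move=> xy yl; rewrite limn_einf_lim -(cvg_lim _ yl)//.
apply: lee_lim => //; first exact: is_cvg_einfs.
  by apply/cvg_ex; exists l.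
apply: filterS xy => n; apply: le_trans.
by apply: ereal_inf_lbound; exists n => /=.
Qed.

End real_sequences.

(** * Integrals against mixtures and densities *)

Lemma integral_set_indic (R : realType) (d : measure_display)
    (U : measurableType d) (mu : {measure set U -> \bar R}) (D : set U)
    (f : U -> \bar R) :
  (\int[mu]_(x in D) f x = \int[mu]_x ((\1_D x)%:E * f x))%E.
Proof.
rewrite integral_mkcond; apply: eq_integral => x _.
by rewrite patchE indicE; case: ifPn => _; rewrite ?mul1e ?mul0e.
Qed.

(** Fixing an arbitrary measurable type here lets the almost-everywhere filter
    be inferred, which unification does not achieve directly on the
    sigma-algebras generated by a process. *)
Lemma ae_mono (R : realType) (d : measure_display) (U : measurableType d)
    (mu : {measure set U -> \bar R}) (E F : U -> Prop) :
  (forall x, E x -> F x) -> {ae mu, forall x, E x} -> {ae mu, forall x, F x}.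
Proof. by move=> EF; apply: filterS. Qed.

Lemma ae_mono2 (R : realType) (d : measure_display) (U : measurableType d)
    (mu : {measure set U -> \bar R}) (E F G : U -> Prop) :
  (forall x, E x -> F x -> G x) -> {ae mu, forall x, E x} ->
  {ae mu, forall x, F x} -> {ae mu, forall x, G x}.
Proof. by move=> EFG; apply: filterS2. Qed.

Section mixtures.
Local Open Scope ereal_scope.
Context (R : realType) (d1 d2 : measure_display).
Context (T1 : measurableType d1) (T2 : measurableType d2).

Section mixture.
Variables (nu : {measure set T1 -> \bar R}) (rho : T1 -> R).
Hypothesis rho0 : forall w, (0 <= rho w)%R.
Hypothesis mrho : measurable_fun [set: T1] rho.
Variable k : T1 -> {measure set T2 -> \bar R}.
Hypothesis mk : forall C, measurable C -> measurable_fun [set: T1] (k ^~ C).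
Variable m : {measure set T2 -> \bar R}.
Hypothesis mE : forall C, measurable C -> m C = \int[nu]_w ((rho w)%:E * k w C).

Import HBNNSimple.

Let mixture_nnsfun (g : {nnsfun T2 >-> R}) :
  \int[m]_y (g y)%:E = \int[nu]_w ((rho w)%:E * \int[k w]_y (g y)%:E).
Proof.
have fsE (mu : {measure set T2 -> \bar R}) : \int[mu]_y (g y)%:E =
    \sum_(r \in range g) (r%:E * mu (g @^-1` [set r])).
  by rewrite integralT_nnsfun sintegralE.
rewrite fsE; under [RHS]eq_integral do rewrite fsE.
have nn (mu : {measure set T2 -> \bar R}) r :
    0 <= r%:E * mu (g @^-1` [set r]).
  apply: (mulemu_ge0 (fun n => g @^-1` [set n])) => //.
  exact: preimage_nnfun0.
under eq_integral do rewrite ge0_mule_fsumr//.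
rewrite ge0_integral_fsum//; last 2 first.
  - move=> r; apply: emeasurable_funM => //; first exact/measurable_EFinP.
    by apply: measurable_funeM; apply: mk; exact: measurable_sfunP.
  - by move=> r w _; rewrite mule_ge0// lee_fin.
apply: eq_fsbigr => r _; have [r0|r0] := leP 0%R r.
  rewrite mE// -ge0_integralZl//; last 2 first.
  - by apply: emeasurable_funM => //; first exact/measurable_EFinP; exact: mk.
  - by move=> w _; rewrite mule_ge0// lee_fin.
  by apply: eq_integral => w _; rewrite muleCA.
rewrite preimage_nnfun0// measure0 mule0 integral0_eq// => w _.
by rewrite measure0 !mule0.
Qed.

(** Fubini for a kernel: an identity between values on sets propagates to
    integrals, first for simple functions and then by monotone convergence on
    both sides. *)
Lemma integral_mixture (g : T2 -> \bar R) : (forall y, 0 <= g y) ->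
  measurable_fun [set: T2] g ->
  \int[m]_y g y = \int[nu]_w ((rho w)%:E * \int[k w]_y g y).
Proof.
move=> g0 mg; pose g_ := nnsfun_approx measurableT mg.
have mg_ n : measurable_fun [set: T2] (EFin \o g_ n) by exact/measurable_EFinP.
have g_0 n y : 0 <= (EFin \o g_ n) y by rewrite lee_fin.
have g_nd y : {homo (fun n => (EFin \o g_ n) y) : a b / (a <= b)%N >-> a <= b}.
  by move=> a b ab; rewrite lee_fin; exact/lefP/nd_nnsfun_approx.
have gE y : g y = limn (fun n => (EFin \o g_ n) y).
  by apply/esym/cvg_lim => //; exact: cvg_nnsfun_approx.
have intE (mu : {measure set T2 -> \bar R}) :
    \int[mu]_y g y = limn (fun n => \int[mu]_y (EFin \o g_ n) y).
  under eq_integral do rewrite gE.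
  by rewrite monotone_convergence.
have int_nd (mu : {measure set T2 -> \bar R}) :
    {homo (fun n => \int[mu]_y (EFin \o g_ n) y) : a b / (a <= b)%N >-> a <= b}.
  by move=> a b ab; apply: ge0_le_integral => // y _; exact: g_nd.
rewrite intE; under eq_fun do rewrite mixture_nnsfun.
rewrite -monotone_convergence//.
- apply: eq_integral => w _; rewrite intE limeMl//.
  by apply: ereal_nondecreasing_is_cvgn; exact: int_nd.
- move=> n; apply: emeasurable_funM => //; first exact/measurable_EFinP.
  exact: (measurable_fun_integral_kernel mk (g_0 n) (mg_ n)).
- move=> n w _; apply: mule_ge0; first by rewrite lee_fin.
  by apply: integral_ge0 => y _; exact: g_0.
- by move=> w _ a b ab; apply: lee_wpmul2l; [rewrite lee_fin|exact: int_nd].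
Qed.

End mixture.
End mixtures.

Section density.
Local Open Scope ereal_scope.
Context (R : realType) (d1 d2 : measure_display).
Context (T1 : measurableType d1) (T2 : measurableType d2).

(** The case of Dirac kernels.  The measure [nu] is arbitrary: the dominating
    measure of a transition density need not be sigma-finite.  The two measures
    may live on different sigma-algebras, which is what restricting a law to
    [F_t] requires. *)
Lemma integral_density_pushforward (nu : {measure set T1 -> \bar R})
    (rho : T1 -> R) (phi : T1 -> T2) (m : {measure set T2 -> \bar R})
    (g : T2 -> \bar R) :
  (forall w, (0 <= rho w)%R) -> measurable_fun [set: T1] rho ->
  measurable_fun [set: T1] phi ->
  (forall C, measurable C -> m C = \int[nu]_(w in phi @^-1` C) (rho w)%:E) ->
  (forall y, 0 <= g y) -> measurable_fun [set: T2] g ->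
  \int[m]_y g y = \int[nu]_w ((rho w)%:E * g (phi w)).
Proof.
move=> rho0 mrho mphi mE g0 mg.
rewrite (@integral_mixture _ _ _ _ _ nu rho rho0 mrho (fun w => dirac (phi w)))//.
- apply: eq_integral => w _; rewrite integral_dirac// diracT mul1e//.
- move=> C mC; apply/measurable_EFinP.
  have mi : measurable_fun [set: T2] (\1_C : T2 -> R) by exact: measurable_indic.
  exact: measurableT_comp mi mphi.
- move=> C mC; rewrite mE// integral_mkcond; apply: eq_integral => w _.
  rewrite patchE /= diracE.
  have -> : (w \in phi @^-1` C) = (phi w \in C) by apply/idP/idP; rewrite !inE.
  by case: ifPn => _; rewrite ?mule1 ?mule0.
Qed.

End density.

Section density_measure.
Local Open Scope ereal_scope.
Context (R : realType) (d : measure_display) (U : measurableType d).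
Variables (nu : {measure set U -> \bar R}) (rho : U -> R).
Hypotheses (rho0 : forall x, (0 <= rho x)%R).
Hypothesis mrho : measurable_fun [set: U] rho.

Let mu (B : set U) : \bar R := \int[nu]_(x in B) (rho x)%:E.

Let mu0 : mu set0 = 0. Proof. by rewrite /mu integral_set0. Qed.

Let mu_ge0 B : 0 <= mu B.
Proof. by apply: integral_ge0 => x _; rewrite lee_fin. Qed.

Let mu_sigma_additive : semi_sigma_additive mu.
Proof.
move=> F mF tF mUF; rewrite /mu ge0_integral_bigcup//.
- apply: is_cvg_ereal_nneg_natsum_cond => n _ _; exact: mu_ge0.
- by apply: measurable_funTS; exact/measurable_EFinP.
- by move=> x _; rewrite lee_fin.
Qed.

HB.instance Definition _ := isMeasure.Build _ _ _ mu mu0 mu_ge0 mu_sigma_additive.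

Lemma measure_of_density :
  exists m : {measure set U -> \bar R}, forall B,
    m B = \int[nu]_(x in B) (rho x)%:E.
Proof. by exists mu. Qed.

End density_measure.

(** * Two laws related by a density on an event *)

Section change_of_law.
(* [rho] is the density of interest, which is known to be nonnegative only
   almost everywhere on [E]; [rho'] is a nonnegative version of it. *)
Local Open Scope ereal_scope.
Context (R : realType) (d : measure_display) (U : measurableType d).
Variables (Q1 Q0 : probability U R) (E : set U) (rho rho' : U -> R).
Hypotheses (mE : measurable E) (mrho : measurable_fun [set: U] rho).
Hypotheses (rho'0 : forall x, (0 <= rho' x)%R).
Hypothesis mrho' : measurable_fun [set: U] rho'.
Hypothesis rhoE : {ae Q0, forall x, E x -> rho' x = rho x}.
Hypothesis Q1E : forall B, measurable B ->
  Q1 (B `&` E) = \int[Q0]_(x in B `&` E) (rho' x)%:E.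

Let m1E : measurable_fun [set: U] (\1_E : U -> R).
Proof. exact: measurable_indic. Qed.

Lemma ge0_integral_change_of_law (g : U -> \bar R) :
  (forall x, 0 <= g x) -> measurable_fun [set: U] g ->
  \int[Q1]_x ((\1_E x)%:E * g x) = \int[Q0]_x ((rho' x * \1_E x)%:E * g x).
Proof.
move=> g0 mg; have r0 x : (0 <= rho' x * \1_E x)%R by rewrite mulr_ge0.
transitivity (\int[mrestr Q1 mE]_x g x); apply/esym.
  apply: (integral_density_pushforward (rho := \1_E) (phi := id)) => //.
  by move=> C mC; rewrite integral_indic// setIC.
apply/esym; apply: (integral_density_pushforward (phi := id)) => //.
  exact: measurable_funM.
move=> C mC; rewrite /= /mrestr Q1E// preimage_id.
rewrite [LHS]integral_set_indic [RHS]integral_set_indic.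
by apply: eq_integral => x _; rewrite indicI -!EFinM /=; congr EFin; ring.
Qed.

Let funepos_mulr (f r : U -> R) x : (0 <= r x)%R ->
  (fun x => (f x * r x)%:E)^\+ x = (r x)%:E * (EFin \o f)^\+ x.
Proof. by move=> r0; rewrite !funeposE maxe_pMr// mule0 -EFinM mulrC. Qed.

Let funeneg_mulr (f r : U -> R) x : (0 <= r x)%R ->
  (fun x => (f x * r x)%:E)^\- x = (r x)%:E * (EFin \o f)^\- x.
Proof.
by move=> r0; rewrite !funenegE maxe_pMr// mule0 muleN -EFinM mulrC.
Qed.

(** The integrand has no sign and need not be integrable, so both sides are
    compared through positive and negative parts. *)
Lemma integral_change_of_law (f : U -> R) : measurable_fun [set: U] f ->
  \int[Q1]_x (f x * \1_E x)%:E = \int[Q0]_x (f x * rho x * \1_E x)%:E.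
Proof.
move=> mf; transitivity (\int[Q0]_x (f x * (rho' x * \1_E x))%:E); last first.
  apply: ae_eq_integral => //.
  - by apply/measurable_EFinP; do 2?apply: measurable_funM.
  - by apply/measurable_EFinP; do 2?apply: measurable_funM.
  - apply: ae_mono rhoE => x rx _; congr EFin; rewrite indicE.
    by have [/set_mem /rx ->|_] := boolP (x \in E); rewrite ?mulr1// !mulr0.
have mfE : measurable_fun [set: U] (EFin \o f) by exact/measurable_EFinP.
rewrite integralE [RHS]integralE; congr (_ - _).
- under eq_integral do rewrite funepos_mulr//.
  under [RHS]eq_integral do rewrite funepos_mulr ?mulr_ge0//.
  by apply: ge0_integral_change_of_law => //; exact: measurable_funepos.
- under eq_integral do rewrite funeneg_mulr//.
  under [RHS]eq_integral do rewrite funeneg_mulr ?mulr_ge0//.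
  by apply: ge0_integral_change_of_law => //; exact: measurable_funeneg.
Qed.

Section full_event.
Hypotheses (Q0_full : Q0 E = 1) (Q1_full : Q1 E = 1).

Let full (Q : probability U R) (B : set U) : Q E = 1 -> measurable B ->
  Q (B `&` E) = Q B.
Proof.
move=> QE mB; have nE : Q (~` E) = 0 by rewrite probability_setC// QE subee.
have -> : Q B = Q (B `&` E) + Q (B `&` ~` E).
  rewrite -measureU; [|exact: measurableI| |].
  - by rewrite -setIUr setUCr setIT.
  - by apply: measurableI => //; exact: measurableC.
  - by rewrite setIACA setICr setI0.
rewrite [X in _ + X](_ : _ = 0) ?adde0//.
by apply: subset_measure0 nE => //; [apply: measurableI => //|];
  exact: measurableC.
Qed.

Let Q1_density (B : set U) : measurable B ->
  Q1 B = \int[Q0]_(x in B) (rho x)%:E.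
Proof.
move=> mB; rewrite -[LHS]full// Q1E//; apply/esym.
have nE : Q0 (~` E) = 0 by rewrite probability_setC// Q0_full subee.
have aeE : {ae Q0, forall x, E x}.
  by exists (~` E); split => //; exact: measurableC.
rewrite [RHS]integral_set_indic [LHS]integral_set_indic.
have m1B : measurable_fun [set: U] (\1_B : U -> R) by exact: measurable_indic.
apply: ae_eq_integral => //.
- by under eq_fun do rewrite -EFinM; apply/measurable_EFinP; exact: measurable_funM.
- under eq_fun do rewrite -EFinM; apply/measurable_EFinP; apply: measurable_funM => //.
  by apply: measurable_indic; exact: measurableI.
- apply: ae_mono2 rhoE aeE => x rx Ex _; rewrite -rx// indicI /=.
  by rewrite (indicE _ E) mem_set// mulr1.
Qed.

Lemma dominated_change_of_law : Q1 `<< Q0.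
Proof.
apply/null_content_dominatesP => B mB B0; rewrite Q1_density//.
by apply: null_set_integral => //; apply: measurable_funTS; exact/measurable_EFinP.
Qed.

Lemma Radon_Nikodym_change_of_law :
  ae_eq Q0 [set: U] (Radon_Nikodym (charge_of_finite_measure Q1) Q0)
    (fun x => (rho x)%:E).
Proof.
have dom := dominated_change_of_law.
apply: integral_ae_eq => //.
- exact: Radon_Nikodym_integrable.
- exact/measurable_EFinP.
- by move=> B _ mB; rewrite -Radon_Nikodym_integral// -Q1_density.
Qed.

Lemma equivalent_change_of_law : {ae Q0, forall x, (0 < rho x)%R} -> Q0 `<< Q1.
Proof.
move=> rho_gt0; apply/null_content_dominatesP => B mB B0.
rewrite -(full Q0_full mB).
have mBE : measurable (B `&` E) by exact: measurableI.
have mB' : measurable_fun (B `&` E) (EFin \o rho').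
  by apply: measurable_funTS; exact/measurable_EFinP.
have /(ae_eq_integral_abs Q0 mBE mB') z :
    \int[Q0]_(x in B `&` E) `|(EFin \o rho') x| = 0.
  under eq_integral do rewrite gee0_abs ?lee_fin//.
  by rewrite -Q1E// (full Q1_full mB).
have : {ae Q0, forall x, ~ (B `&` E) x}.
  have zr : {ae Q0, forall x, (B `&` E) x -> rho x = 0%R}.
    apply: (ae_mono2 _ z rhoE) => x zx rx BEx.
    by rewrite -rx; [have [] := zx BEx|case: BEx].
  by apply: (ae_mono2 _ zr rho_gt0) => x zx rx /zx r0; rewrite r0 ltxx in rx.
move=> [N [mN N0 sub]]; apply: subset_measure0 N0 => //.
by move=> x BEx; apply: sub => /=; exact.
Qed.

End full_event.
End change_of_law.

(** * The natural filtration *)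

Section filtration.
Context (R : realType) (d : measure_display) (Omega : measurableType d).
Context (S : ptopologicalType) (X : R -> Omega -> S).

(** Generators of [natural_filtration X t]; they make
    [g_sigma_algebraType (past t)] a measurable type whose measurable functions
    are the [F_t]-measurable ones. *)
Definition past (t : R) : set (set Omega) :=
  \bigcup_(s in `[0, t])
    preimage_set_system [set: Omega] (X s) (@measurable _ (borel S)).

Local Notation F t := (g_sigma_algebraType (past t)).

Lemma natural_filtration_le s t :
  s <= t -> natural_filtration X s `<=` natural_filtration X t.
Proof.
move=> st; apply: sub_sigma_algebra2; apply: bigcup_subset => u /=.
by rewrite !in_itv/= => /andP[-> /le_trans]; exact.
Qed.

Lemma natural_filtrationI t A B : natural_filtration X t A ->
  natural_filtration X t B -> natural_filtration X t (A `&` B).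
Proof. exact: (@measurableI _ (F t)). Qed.

Lemma natural_filtrationC t A :
  natural_filtration X t A -> natural_filtration X t (~` A).
Proof. exact: (@measurableC _ (F t)). Qed.

Lemma natural_filtrationT t : natural_filtration X t [set: Omega].
Proof. exact: (@measurableT _ (F t)). Qed.

Lemma natural_filtration_preimage t U : 0 <= t ->
  measurable (U : set (borel S)) -> natural_filtration X t (X t @^-1` U).
Proof.
move=> t0 mU; apply: sub_sigma_algebra; exists t => /=.
  by rewrite in_itv/= t0 lexx.
by exists U => //; rewrite setTI.
Qed.

Lemma measurable_fun_state t : 0 <= t ->
  measurable_fun [set: F t] (X t : F t -> borel S).
Proof.
by move=> t0 _ U mU; rewrite setTI; exact: natural_filtration_preimage.
Qed.

Section terminal.
Variable T : R.

Lemma natural_filtration_measurable t :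
  (forall s, 0 <= s <= T ->
    measurable_fun [set: Omega] (X s : Omega -> borel S)) ->
  t <= T -> natural_filtration X t `<=` measurable.
Proof.
move=> mX tT; apply: smallest_sub; first exact: sigma_algebra_measurable.
move=> A [s /=]; rewrite in_itv/= => /andP[s0 st] [U mU <-].
by apply: mX => //; rewrite s0 (le_trans st).
Qed.

Lemma measurable_fun_adapted (d' : measure_display) (U : measurableType d') t
    (Y : Omega -> U) :
  (forall s, 0 <= s <= T ->
    measurable_fun [set: Omega] (X s : Omega -> borel S)) ->
  t <= T -> measurable_fun [set: F t] Y -> measurable_fun [set: Omega] Y.
Proof.
by move=> mX tT mY _ V mV; apply: (natural_filtration_measurable mX tT); exact: mY.
Qed.

Lemma natural_filtration_pre_terminal t : 0 <= t < T ->
  natural_filtration X t `<=` <<s pre_terminal X T >>.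
Proof.
by move=> tT A FA; apply: sub_sigma_algebra; exists t.
Qed.

Lemma measurable_fun_pre_terminal (d' : measure_display)
    (U : measurableType d') t (Y : Omega -> U) : 0 <= t < T ->
  measurable_fun [set: F t] Y ->
  measurable_fun [set: g_sigma_algebraType (pre_terminal X T)] Y.
Proof.
by move=> tT mY _ V mV; apply: (natural_filtration_pre_terminal tT); exact: mY.
Qed.

Lemma pre_terminalI : setI_closed (pre_terminal X T).
Proof.
move=> A B [s /= sI As] [t /= tI Bt].
have [st|ts] := leP s t; [exists t|exists s] => //; apply: natural_filtrationI => //.
  exact: natural_filtration_le As.
by apply: natural_filtration_le Bt; exact: ltW.
Qed.

(** [Q] has density [D] with respect to [P] on [F_t] only, hence [Y] has to be
    [F_t]-measurable: the law of the identity map into [F_t] is the measure to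
    which the density formula applies. *)
Lemma integral_restricted_density (P : {measure set Omega -> \bar R})
    (Q : {measure set (g_sigma_algebraType (pre_terminal X T)) -> \bar R})
    (t : R) (D : Omega -> R) (Y : Omega -> \bar R) :
  (forall s, 0 <= s <= T ->
    measurable_fun [set: Omega] (X s : Omega -> borel S)) ->
  0 <= t < T ->
  (forall w, 0 <= D w) -> measurable_fun [set: F t] D ->
  (forall B, natural_filtration X t B -> Q B = (\int[P]_(w in B) (D w)%:E)%E) ->
  (forall w, 0 <= Y w)%E -> measurable_fun [set: F t] Y ->
  (\int[Q]_w Y w = \int[P]_w ((D w)%:E * Y w))%E.
Proof.
move=> mX tT D0 mD QE Y0 mY.
have tT' : t <= T by case/andP: tT => _ /ltW.
have mid : measurable_fun [set: g_sigma_algebraType (pre_terminal X T)]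
    (id : g_sigma_algebraType (pre_terminal X T) -> F t).
  by move=> _ B mB; rewrite setTI; exact: (natural_filtration_pre_terminal tT).
pose tomid := isMeasurableFun.Build _ _ _ _ _ mid.
pose idt : {mfun g_sigma_algebraType (pre_terminal X T) >-> F t} :=
  HB.pack id tomid.
have -> : (\int[Q]_w Y w = \int[pushforward Q idt]_w Y w)%E.
  by rewrite (ge0_integral_pushforward mid).
rewrite (@integral_density_pushforward _ _ _ _ (F t) P D id (pushforward Q idt))//.
- exact: measurable_fun_adapted mD.
- by move=> _ B mB; rewrite setTI; exact: (natural_filtration_measurable mX tT').
Qed.

End terminal.
End filtration.

(** * The Markov property and the function hsharp *)

Section markov.
Context (R : realType) (d : measure_display) (Omega : measurableType d).
Context (S : ptopologicalType) (X : R -> Omega -> S) (P : probability Omega R).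
Variables (T : R) (K : R -> R -> R.-pker (borel S) ~> (borel S)).
Hypothesis X_markov : markov_process P T X K.

Let mX := X_markov.1.

(** The Markov property is given for indicators of [C]; the law of [X t] on
    [B] is a mixture of the kernels [K s t (X s w)], which extends it to
    functions. *)
Lemma markov_integral s t B (g : borel S -> \bar R) :
  0 <= s -> s <= t -> t <= T -> natural_filtration X s B ->
  (forall y, 0 <= g y)%E -> measurable_fun [set: borel S] g ->
  (\int[P]_(w in B) g (X t w) = \int[P]_(w in B) \int[K s t (X s w)]_y g y)%E.
Proof.
move=> s0 st tT FB g0 mg.
have sT : 0 <= s <= T by rewrite s0 (le_trans st).
have tT' : 0 <= t <= T by rewrite (le_trans s0 st).
have mB : measurable B.
  by apply: (natural_filtration_measurable mX (le_trans st tT)).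
pose toXt := isMeasurableFun.Build _ _ _ _ _ (mX tT').
pose Xt : {mfun Omega >-> borel S} := HB.pack (X t : Omega -> borel S) toXt.
pose m := pushforward (mrestr P mB) Xt.
have m1B : measurable_fun [set: Omega] (\1_B : Omega -> R).
  exact: measurable_indic.
transitivity (\int[m]_y g y)%E.
  rewrite [LHS]integral_set_indic; apply/esym.
  apply: (@integral_density_pushforward _ _ _ _ _ P (\1_B) Xt m) => //.
  move=> C mC; rewrite /m /pushforward /mrestr integral_indic//.
    by rewrite setIC.
  exact: measurable_funPTI.
rewrite [RHS]integral_set_indic.
have mKX C : measurable C ->
    measurable_fun [set: Omega] (fun w => K s t (X s w) C).
  move=> mC.
  exact: (measurableT_comp (measurable_kernel (K s t) C mC) (mX sT)).
have mE C : measurable C ->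
    m C = (\int[P]_w ((\1_B w)%:E * K s t (X s w) C))%E.
  move=> mC; rewrite -integral_set_indic.
  have [_ /(_ s t s0 st tT B C FB mC) <-] := X_markov.
  by rewrite /m /pushforward /mrestr setIC.
have B0 w : (0 <= \1_B w :> R) by [].
exact: (integral_mixture B0 m1B mKX mE g0 mg).
Qed.

Variables (nu : {measure set (borel S) -> \bar R}) (p : R -> S -> R -> S -> R).
Hypothesis p_density : transition_density T K nu p.
Variables (kappa : R -> R) (ht : R -> S -> R).

(** Rewriting [hsharp] with the kernel instead of the density makes it
    measurable in [x], although the density [p s x t] is only known to be
    measurable in its last argument. *)
Lemma hsharp_kernel s t x : 0 <= s -> s < t -> t <= T -> 0 <= kappa t ->
  (forall y, 0 <= ht t y) -> measurable_fun [set: borel S] (ht t) ->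
  hsharp nu p kappa ht t s x = (\int[K s t x]_y (kappa t * ht t y)%:E)%E.
Proof.
move=> s0 st tT k0 h0 mh; have [p0 mp pE] := p_density x s0 st tT.
rewrite (@integral_density_pushforward _ _ _ _ _ nu (p s x t) id)//.
- by apply: eq_integral => y _; rewrite -EFinM mulrC.
- by move=> y; rewrite lee_fin mulr_ge0.
- by apply/measurable_EFinP; exact: measurable_funM.
Qed.

Lemma measurable_hsharp s t : 0 <= s -> s < t -> t <= T -> 0 <= kappa t ->
  (forall y, 0 <= ht t y) -> measurable_fun [set: borel S] (ht t) ->
  measurable_fun [set: borel S]
    (fun x => hsharp nu p kappa ht t s x : \bar R).
Proof.
move=> s0 st tT k0 h0 mh.
rewrite (_ : hsharp _ _ _ _ _ _ =
    (fun x => \int[K s t x]_y (kappa t * ht t y)%:E)%E); last first.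
  by apply/funext => x; rewrite hsharp_kernel.
apply: measurable_fun_integral_kernel.
- by move=> U mU; exact: measurable_kernel.
- by move=> y; rewrite lee_fin mulr_ge0.
- by apply/measurable_EFinP; exact: measurable_funM.
Qed.

(** The tower property: [hsharp] at [X s] is the conditional expectation of
    [kappa t * ht t (X t)] given the past of [X] up to [s]. *)
Lemma integral_hsharp s t B : 0 <= s -> s < t -> t <= T -> 0 <= kappa t ->
  (forall y, 0 <= ht t y) -> measurable_fun [set: borel S] (ht t) ->
  natural_filtration X s B ->
  (\int[P]_(w in B) hsharp nu p kappa ht t s (X s w) =
   \int[P]_(w in B) (kappa t * ht t (X t w))%:E)%E.
Proof.
move=> s0 st tT k0 h0 mh FB.
under eq_integral do rewrite hsharp_kernel//.
rewrite -(@markov_integral s t B (fun y => (kappa t * ht t y)%:E)) ?(ltW st)//.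
- by move=> y; rewrite lee_fin mulr_ge0.
- by apply/measurable_EFinP; exact: measurable_funM.
Qed.

End markov.

(** * Good functions *)

Section good_functions.
Context (R : realType) (d : measure_display) (Omega : measurableType d).
Context (S : ptopologicalType) (P : probability Omega R) (T : R).
Context (X : R -> Omega -> S) (x0 : S).
Context (L : R -> (S -> R) -> (S -> R)) (DL : set (S -> R)).
Context (DA : set (R -> S -> R)).
Hypothesis mX : forall s, 0 <= s <= T ->
  measurable_fun [set: Omega] (X s : Omega -> borel S).
Hypothesis X_L : generated_by L P T X x0 DL.
Hypothesis X_A : space_time_generated_by L P T X x0 DL DA.
Variable h : R -> S -> R.
Hypothesis h_good : forall u, 0 <= u < T -> good L P X x0 DA u h.

Local Notation F t := (g_sigma_algebraType (past X t)).

Lemma good_gt0 t x : 0 <= t < T -> 0 < h t x.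
Proof.
move=> tT; have [_ h0 _ _] := h_good tT; apply: h0.
by case/andP: tT => -> _; rewrite lexx.
Qed.

Lemma good_measurable t : 0 < t < T -> measurable_fun [set: borel S] (h t).
Proof.
move=> /andP[t0 tT]; have t0T : 0 <= t < T by rewrite ltW.
have [DAh _ _ _] := h_good t0T; have [/(_ t) DLh _ _] := X_A DAh.
have [|/X_L[]//] := DLh.
by rewrite t0.
Qed.

Lemma good_state_measurable t : 0 < t < T ->
  measurable_fun [set: F t] (fun w => h t (X t w)).
Proof.
move=> tT; apply: (measurableT_comp (good_measurable tT)).
by apply: measurable_fun_state; case/andP: tT => /ltW.
Qed.

Lemma Dproc_measurable t : 0 <= t < T ->
  measurable_fun [set: F t] (Dproc L X x0 h t).
Proof.
move=> tT; have [_ _ _ [Dad _ _]] := h_good tT.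
move=> _ U mU; rewrite setTI; apply: Dad => //.
by case/andP: tT => t0 _; rewrite /= in_itv/= t0 lexx.
Qed.

Lemma Dproc_ge0 t w : 0 <= t < T -> 0 <= Dproc L X x0 h t w.
Proof.
move=> /andP[t0 tT]; rewrite /Dproc mulr_ge0 ?expR_ge0// divr_ge0//.
  by apply/ltW/good_gt0; rewrite t0.
by apply/ltW/good_gt0; rewrite lexx (le_lt_trans t0).
Qed.

Lemma Dproc_Psi t w :
  Dproc L X x0 h t w * Psi L X h t w = h t (X t w) / h 0 x0.
Proof.
by rewrite /Dproc /Psi -mulrA -expRD addNr expR0 mulr1.
Qed.

(** [Psi] is defined through a time integral along the path, for which no
    joint measurability of [X] is given.  It is recovered from the adapted
    process [Dproc]; logarithms turn the quotient into a difference. *)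
Lemma Psi_measurable t : 0 < t < T -> measurable_fun [set: F t] (Psi L X h t).
Proof.
move=> /andP[t0 tT].
have t0T : 0 <= t < T by rewrite ltW.
have T0 : 0 <= (0 : R) < T by rewrite lexx (lt_trans t0).
have D0 w : 0 < Dproc L X x0 h t w.
  by rewrite /Dproc !mulr_gt0 ?invr_gt0 ?expR_gt0// good_gt0.
rewrite (_ : Psi _ _ _ _ = fun w =>
    expR (ln (h t (X t w) / h 0 x0) - ln (Dproc L X x0 h t w))); last first.
  apply/funext => w; rewrite -Dproc_Psi lnM ?posrE ?expR_gt0//.
  by rewrite addrAC subrr add0r expRK.
apply: measurableT_comp => //; apply: measurable_funB.
  apply: measurableT_comp => //; apply: measurable_funM => //.
  by apply: good_state_measurable; rewrite t0.
apply: measurableT_comp => //; exact: Dproc_measurable.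
Qed.

(** The generator of [h] may be nonzero at time 0, where two-sided time
    derivatives carry no information, but a single time does not contribute
    to the integral. *)
Lemma Dproc_harmonic t w :
  (forall u x, 0 < u < T -> space_time_generator L h u x = 0) ->
  0 <= t < T -> Dproc L X x0 h t w = h t (X t w) / h 0 x0.
Proof.
move=> Ah0 /andP[t0 tT]; rewrite /Dproc /log_weight.
suff -> : (\int[lebesgue_measure]_(s in `[0, t])
   (space_time_generator L h s (X s w) / h s (X s w))) = 0.
  by rewrite oppr0 expR0 mulr1.
have E s : s \in `]0, t] ->
    space_time_generator L h s (X s w) / h s (X s w) = 0.
  rewrite in_itv/= => /andP[s0 st].
  by rewrite Ah0 ?mul0r// s0 (le_lt_trans st).
rewrite -Rintegral_itv_obnd_cbnd.
  rewrite /Rintegral integral0_eq// => s /= sI.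
  by rewrite E.
apply: (eq_integrable _ (cst 0%E)) => //; last exact: integrable0.
by move=> s; rewrite inE => /E /= ->.
Qed.

End good_functions.

(** * The guided law up to time [T] *)

Section guided.
Context (R : realType) (T : R) (S : ptopologicalType).
Context (d : measure_display) (Omega : measurableType d).
Context (P : probability Omega R) (X : R -> Omega -> S).
Context (K : R -> R -> R.-pker (borel S) ~> (borel S)).
Hypothesis X_markov : markov_process P T X K.
Variable x0 : S.
Hypothesis X_start : {ae P, forall w, X 0 w = x0}.
Variables (L : R -> (S -> R) -> (S -> R)) (DL : set (S -> R)).
Variable DA : set (R -> S -> R).
Hypothesis X_L : generated_by L P T X x0 DL.
Hypothesis X_A : space_time_generated_by L P T X x0 DL DA.
Variables (h ht : R -> S -> R).
Hypothesis h_good : forall u, 0 <= u < T -> good L P X x0 DA u h.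
Hypothesis ht_good : forall u, 0 <= u < T -> good L P X x0 DA u ht.
Hypothesis Ah0 : forall t x, 0 < t < T -> space_time_generator L h t x = 0.
Variables Pstar Pcirc : probability (g_sigma_algebraType (pre_terminal X T)) R.
Hypothesis Pstar_h : is_induced_law L P x0 h Pstar.
Hypothesis Pcirc_ht : is_induced_law L P x0 ht Pcirc.
Variable t0 : R.
Hypothesis t0_T : 0 <= t0 < T.
Variable kappa : R -> R.
Hypothesis kappa_gt0 : forall t, t0 <= t < T -> 0 < kappa t.
Variable A : nat -> R -> set Omega.
Hypothesis A_meas : forall k t, t0 <= t < T -> natural_filtration X t (A k t).
Hypothesis A_nest : forall k s t, t0 <= s -> s <= t -> t <= T ->
    closed_family t0 T A k t `<=` closed_family t0 T A k.+1 t /\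
    closed_family t0 T A k t `<=` closed_family t0 T A k s.
Variables (nu : {measure set (borel S) -> \bar R}) (p : R -> S -> R -> S -> R).
Hypothesis p_density : transition_density T K nu p.
Hypothesis hsharp_cvg : forall s x, 0 <= s < T ->
    hsharp nu p kappa ht t s x @[t --> T^'-] --> (h s x)%:E.

Local Notation F t := (g_sigma_algebraType (past X t)).
Local Notation Om := (g_sigma_algebraType (pre_terminal X T)).

Let mX := X_markov.1.

Let lt0T t : t0 < t < T -> 0 < t < T.
Proof.
by case/andP=> t0t ->; rewrite andbT; case/andP: t0_T => /le_lt_trans /(_ t0t).
Qed.

Let let0T t : t0 < t < T -> 0 <= t < T.
Proof. by move/lt0T/andP=> [/ltW-> ->]. Qed.

Let ltt0 t : t0 < t < T -> t0 <= t < T.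
Proof. by move/andP=> [/ltW-> ->]. Qed.

Let T_ge0 : 0 <= (0 : R) < T.
Proof. by rewrite lexx/=; case/andP: t0_T; exact: le_lt_trans. Qed.

Let h00 : 0 < h 0 x0. Proof. exact: (good_gt0 h_good). Qed.
Let ht00 : 0 < ht 0 x0. Proof. exact: (good_gt0 ht_good). Qed.

Definition guiding_weight (t : R) (w : Omega) : R := kappa t * ht t (X t w).
Local Notation V := guiding_weight.

Let V_ge0 t w : t0 < t < T -> 0 <= V t w.
Proof.
move=> tT; rewrite mulr_ge0// ltW//; first exact/kappa_gt0/ltt0.
exact/(good_gt0 ht_good)/let0T.
Qed.

Let V_measurable t : t0 < t < T -> measurable_fun [set: F t] (V t).
Proof.
move=> /lt0T tT; apply: measurable_funM => //.
exact: (good_state_measurable X_L X_A ht_good tT).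
Qed.

Definition guided_weight (k : nat) (t : R) (w : Omega) : R :=
  Psi L X ht t w * kappa t * \1_(A k t) w.

Let guided_weight_ge0 k t w : t0 < t < T -> 0 <= guided_weight k t w.
Proof.
by move=> tT; rewrite !mulr_ge0 ?expR_ge0// ltW//; exact/kappa_gt0/ltt0.
Qed.

Let guided_weight_measurable k t : t0 < t < T ->
  measurable_fun [set: F t] (guided_weight k t).
Proof.
move=> tT; have FA := A_meas k (ltt0 tT).
have mA : measurable (A k t : set (F t)) by [].
have m1A : measurable_fun [set: F t] (\1_(A k t) : F t -> R).
  exact: measurable_indic.
apply: measurable_funM => //; apply: measurable_funM => //.
exact: (Psi_measurable X_L X_A ht_good (lt0T tT)).
Qed.

Lemma integral_Pstar t B : 0 < t < T -> natural_filtration X t B ->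
  ((h 0 x0)%:E * Pstar B = \int[P]_(w in B) (h t (X t w))%:E)%E.
Proof.
move=> tT FB; have t0T : 0 <= t < T by case/andP: tT => /ltW-> ->.
have tT' : t <= T by case/andP: tT => _ /ltW.
rewrite (Pstar_h t0T FB) -ge0_integralZl//.
- apply: eq_integral => w _.
  by rewrite (Dproc_harmonic X x0 w Ah0 t0T) -EFinM mulrC divfK// gt_eqF.
- exact: (natural_filtration_measurable mX tT').
- apply/measurable_EFinP/measurable_funTS.
  exact: (measurable_fun_adapted mX tT' (Dproc_measurable h_good t0T)).
- by move=> w _; rewrite lee_fin (Dproc_ge0 h_good).
- by rewrite lee_fin ltW.
Qed.

(** The path functional [Psi] cancels against [Dproc]. *)
Lemma integral_Pcirc k t B : t0 < t < T -> natural_filtration X t B ->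
  ((ht 0 x0)%:E * \int[Pcirc]_(w in B) (guided_weight k t w)%:E
   = \int[P]_(w in B `&` A k t) (V t w)%:E)%E.
Proof.
move=> tT FB; have t0T := let0T tT.
have tT' : t <= T by case/andP: tT => _ /ltW.
have mB : measurable (B : set (F t)) by [].
have m1B : measurable_fun [set: F t] (\1_B : F t -> R).
  exact: measurable_indic.
have mW := guided_weight_measurable k tT.
have W0 w := guided_weight_ge0 k w tT.
have Y0 w : (0 <= (\1_B w)%:E * (guided_weight k t w)%:E)%E.
  by rewrite mule_ge0// lee_fin.
have mY : measurable_fun [set: F t]
    (fun w => (\1_B w)%:E * (guided_weight k t w)%:E)%E.
  by apply: emeasurable_funM; exact/measurable_EFinP.
have mD := Dproc_measurable ht_good t0T.
have D0 w : 0 <= Dproc L X x0 ht t w by exact: (Dproc_ge0 ht_good).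
rewrite integral_set_indic.
rewrite (integral_restricted_density mX t0T D0 mD (Pcirc_ht t0T) Y0 mY).
rewrite -ge0_integralZl//; last 3 first.
- apply: emeasurable_funM.
    exact/measurable_EFinP/(measurable_fun_adapted mX tT' mD).
  exact: (measurable_fun_adapted mX tT' mY).
- by move=> w _; rewrite mule_ge0// lee_fin.
- by rewrite lee_fin ltW.
rewrite [RHS]integral_set_indic; apply: eq_integral => w _.
rewrite -!EFinM; congr EFin; rewrite indicI /guided_weight /V /=.
have htE : ht t (X t w) =
    ht 0 x0 * (Dproc L X x0 ht t w * Psi L X ht t w).
  by rewrite Dproc_Psi mulrC divfK// gt_eqF.
by rewrite /guiding_weight htE; ring.
Qed.

(** The limit of [hsharp] at [s = 0], where [X] is deterministic. *)
Lemma cvg_mass : (\int[P]_w (V t w)%:E)%E @[t --> T^'-] --> (h 0 x0)%:E.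
Proof.
apply: cvg_trans (@hsharp_cvg 0 x0 T_ge0); apply: near_eq_cvg.
near=> t.
have tT : t0 < t < T.
  by apply/andP; split; near: t;
    [apply: nbhs_left_gt; case/andP: t0_T|exact: nbhs_left_lt].
have [t_gt0 t_T] := andP (lt0T tT).
have k0 : 0 <= kappa t by apply/ltW/kappa_gt0/ltt0.
have h0 y : 0 <= ht t y by apply/ltW/(good_gt0 ht_good)/let0T.
have mh := good_measurable X_L X_A ht_good (lt0T tT).
have FT : natural_filtration X 0 [set: Omega] by exact: natural_filtrationT.
have := integral_hsharp X_markov p_density (lexx 0) t_gt0 (ltW t_T) k0 h0 mh FT.
move=> <-.
have mhs := measurable_hsharp p_density (lexx 0) t_gt0 (ltW t_T) k0 h0 mh.
transitivity (\int[P]_(w in [set: Omega]) cst (hsharp nu p kappa ht t 0 x0) w)%E.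
  by rewrite integral_cst//= probability_setT mule1.
apply: ae_eq_integral => //.
  apply: measurableT_comp mhs _.
  by apply: mX; rewrite lexx ltW// (lt_trans t_gt0).
by apply: filterS X_start => w Xw _ /=; rewrite Xw.
Unshelve. all: by end_near. Qed.

(* Limits as [t] increases to [T] are taken along this sequence. *)
Local Notation u := (approach t0 T).

Let t0T' : t0 < T. Proof. by case/andP: t0_T. Qed.

Let u_itv n : t0 < u n < T. Proof. exact: approach_itv. Qed.

(** Fatou's lemma for the conditional expectations [hsharp] of [V].  Only this
    inequality survives on a fixed event; the matching upper bound comes from
    the complement and the total mass. *)
Lemma Pstar_le_limn_einf s B : 0 < s < T -> natural_filtration X s B ->
  ((h 0 x0)%:E * Pstar B <=
   limn_einf (fun n => \int[P]_(w in B) (V (u n) w)%:E))%E.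
Proof.
move=> sT FB; have [s0 s_T] := andP sT.
have sT' : 0 <= s < T by rewrite ltW.
have mB : measurable B.
  by apply: (natural_filtration_measurable mX (ltW s_T)).
have k0 n : 0 <= kappa (u n) by apply/ltW/kappa_gt0/ltt0.
have ht0 n y : 0 <= ht (u n) y by apply/ltW/(good_gt0 ht_good)/let0T.
have mht n := good_measurable X_L X_A ht_good (lt0T (u_itv n)).
have unT n : u n <= T by case/andP: (u_itv n) => _ /ltW.
(* Fatou's lemma needs all terms to be measurable, also the finitely many
   ones with [u n <= s], for which [hsharp] is not a conditional expectation. *)
pose f n w : \bar R :=
  if s < u n then hsharp nu p kappa ht (u n) s (X s w) else (V (u n) w)%:E.
have f0 n w : (0 <= f n w)%E.
  rewrite /f; case: ifPn => sn; last by rewrite lee_fin V_ge0.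
  rewrite (hsharp_kernel p_density) ?(ltW s0)//.
  by apply: integral_ge0 => y _; rewrite lee_fin mulr_ge0.
have mf n : measurable_fun B (f n).
  apply: measurable_funTS; rewrite /f.
  case: (boolP (s < u n)) => [sn|_].
    have mh := measurable_hsharp p_density (ltW s0) sn (unT n) (k0 n)
      (ht0 n) (mht n).
    apply: (measurableT_comp mh).
    by apply: mX; rewrite !ltW.
  apply/measurable_EFinP.
  exact: (measurable_fun_adapted mX (unT n) (V_measurable (u_itv n))).
have fE n : (\int[P]_(w in B) (V (u n) w)%:E = \int[P]_(w in B) f n w)%E.
  rewrite /f; case: (boolP (s < u n)) => // sn.
  by rewrite (integral_hsharp X_markov p_density (ltW s0) sn (unT n) (k0 n)
    (ht0 n) (mht n) FB).
under eq_fun do rewrite fE.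
rewrite (integral_Pstar sT FB).
apply: le_trans (fatou P mB mf (fun n w _ => f0 n w)).
rewrite le_eqVlt; apply/orP; left; apply/eqP; apply: eq_integral => w _.
apply/esym; rewrite limn_einf_lim; apply/cvg_lim => //; apply: cvg_einfs.
apply: cvg_trans; last first.
  exact: (cvg_comp _ _ (cvg_approach t0T') (@hsharp_cvg s (X s w) sT')).
apply: near_eq_cvg; apply: filterS (near_approach t0T' s_T) => n sn /=.
by rewrite /f sn.
Qed.

Definition limit_event k : set Omega := closed_family t0 T A k T.

Lemma limit_eventE k : limit_event k = \bigcap_n A k (u n).
Proof.
rewrite /limit_event /closed_family ltxx; apply/seteqP; split=> w Aw.
  by move=> n _; apply: Aw; rewrite /= in_itv/= ltt0.
move=> s /=; rewrite in_itv/= => /andP[t0s sT].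
have [N _ /(_ N (leqnn _))] := near_approach t0T' sT.
move=> sN; have /andP[_ uT] := u_itv N.
have [_] := @A_nest k s (u N) t0s (ltW sN) (ltW uT).
by rewrite /closed_family uT sT; apply; exact: Aw.
Qed.

Lemma limit_event_measurable k : measurable (limit_event k : set Om).
Proof.
rewrite limit_eventE; apply: bigcapT_measurable => n.
apply: (@natural_filtration_pre_terminal _ _ _ _ _ _ (u n) (let0T (u_itv n))).
by apply: A_meas; exact: ltt0.
Qed.

Lemma nested_events k m n : (m <= n)%N -> A k (u n) `<=` A k (u m).
Proof.
move=> mn; have [/andP[t0m umT] /andP[t0n unT]] := (u_itv m, u_itv n).
have [_] := @A_nest k (u m) (u n) (ltW t0m) (approach_nd t0T' mn) (ltW unT).
by rewrite /closed_family umT unT.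
Qed.

Lemma limit_event_nd k l : (k <= l)%N -> limit_event k `<=` limit_event l.
Proof.
move=> /subnK <-; elim: (l - k)%N => // n IH; rewrite addSn.
apply: subset_trans IH _.
have [t00 _] := andP t0_T.
by have [] := @A_nest (n + k)%N t0 T (lexx _) (ltW t0T') (lexx _).
Qed.

Variable PsiT : Om -> R.
Hypothesis PsiT_meas : measurable_fun [set: Om] PsiT.
Hypothesis PsiT_lim : forall k, {ae Pcirc, forall w,
    (Psi L X ht t w * kappa t * \1_(A k t) w) @[t --> T^'-] -->
      PsiT w * \1_(limit_event k) w}.
Hypothesis bounded : forall k, exists C : R,
    {ae Pcirc, forall w, forall t, t0 <= t < T ->
      Psi L X ht t w * kappa t * \1_(A k t) w <= C}.

(** Dominated convergence, with the uniform bound on the weights.  The limit is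
    integrable, so it can be subtracted from the total mass. *)
Lemma cvg_guided_weight k (B : set Om) : measurable B ->
  Pcirc.-integrable B (fun w => (PsiT w * \1_(limit_event k) w)%:E) /\
  (\int[Pcirc]_(w in B) (guided_weight k (u n) w)%:E)%E @[n --> \oo] -->
  (\int[Pcirc]_(w in B) (PsiT w * \1_(limit_event k) w)%:E)%E.
Proof.
move=> mB; have [C bC] := bounded k.
have m1 : measurable_fun [set: Om] (\1_(limit_event k) : Om -> R).
  by apply: measurable_indic; exact: limit_event_measurable.
have mlim : measurable_fun B
    (fun w : Om => (PsiT w * \1_(limit_event k) w)%:E).
  by apply: measurable_funTS; apply/measurable_EFinP; exact: measurable_funM.
have mW n : measurable_fun B (fun w : Om => (guided_weight k (u n) w)%:E).
  apply: measurable_funTS; apply/measurable_EFinP.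
  exact: (measurable_fun_pre_terminal (let0T (u_itv n))
            (guided_weight_measurable k (u_itv n))).
have lim_ae : {ae Pcirc, forall w, B w -> (fun n => (guided_weight k (u n) w)%:E)
    @ \oo --> (PsiT w * \1_(limit_event k) w)%:E}.
  apply: ae_mono (PsiT_lim k) => w cw _.
  apply: cvg_EFin; first exact: nearW.
  exact: (cvg_comp _ _ (cvg_approach t0T') cw).
have iC : Pcirc.-integrable B (cst `|C|%:E) by exact: finite_measure_integrable_cst.
have bd : {ae Pcirc, forall w n, B w ->
    (`|(guided_weight k (u n) w)%:E| <= (cst `|C|%:E) w)%E}.
  apply: ae_mono bC => w bw n _.
  rewrite gee0_abs ?lee_fin ?guided_weight_ge0//.
  by rewrite (le_trans (bw _ (ltt0 (u_itv n)))) ?ler_norm.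
by have [] := dominated_convergence mB mW mlim lim_ae iC bd.
Qed.

(** [PsiT] is a limit of nonnegative weights where the indicator is one. *)
Lemma PsiT_ge0 : {ae Pcirc, forall w, forall k, limit_event k w -> 0 <= PsiT w}.
Proof.
apply: ae_foralln => k; apply: ae_mono (PsiT_lim k) => w cw kw.
rewrite indicE mem_set//= mulr1 in cw.
apply: (cvgr_to_ge cw).
near=> t; apply: guided_weight_ge0.
by apply/andP; split; near: t; [exact: nbhs_left_gt|exact: nbhs_left_lt].
Unshelve. all: by end_near. Qed.

(** With [C = B `&` A k (u m)], the masses of [V (u n)] on [~` C] and on
    [B `&` A k (u n)] add up to at most the total mass when [m <= n], because
    the events decrease in time.  In the limit the first is at least
    [h 0 x0 * Pstar (~` C)] and the total is [h 0 x0]. *)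
Lemma guided_le_conditioned_before k m B :
  natural_filtration X (u m) B ->
  ((ht 0 x0)%:E * \int[Pcirc]_(w in B) (PsiT w * \1_(limit_event k) w)%:E
   <= (h 0 x0)%:E * Pstar (B `&` A k (u m)))%E.
Proof.
move=> FB; have um := u_itv m; have umT := lt0T um.
pose C := B `&` A k (u m).
have FC : natural_filtration X (u m) C.
  by apply: natural_filtrationI => //; apply: A_meas; exact: ltt0.
have FnC := natural_filtrationC FC.
have mF n D : natural_filtration X (u n) D -> measurable D.
  by apply: (natural_filtration_measurable mX); case/andP: (u_itv n) => _ /ltW.
have mOm n D : natural_filtration X (u n) D -> measurable (D : set Om).
  by apply: natural_filtration_pre_terminal; exact: let0T (u_itv n).
have mB := mOm _ _ FB.
have [iI cI] := cvg_guided_weight k mB.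
set I := (\int[Pcirc]_(w in B) _)%E in cI *.
have finI : I \is a fin_num by exact: integrable_fin_num iI.
pose W n := (\int[Pcirc]_(w in B) (guided_weight k (u n) w)%:E)%E.
have cW : ((ht 0 x0)%:E * W n)%E @[n --> \oo] --> ((ht 0 x0)%:E * I)%E.
  by apply: cvgeZl.
have cV : (\int[P]_w (V (u n) w)%:E)%E @[n --> \oo] --> (h 0 x0)%:E.
  exact: (cvg_comp _ _ (cvg_approach t0T') cvg_mass).
have finhI : ((ht 0 x0)%:E * I)%E \is a fin_num by rewrite fin_numM.
have mV n D : measurable D -> measurable_fun D (fun w => (V (u n) w)%:E).
  move=> _; apply: measurable_funTS; apply/measurable_EFinP.
  apply: (measurable_fun_adapted mX _ (V_measurable (u_itv n))).
  by case/andP: (u_itv n) => _ /ltW.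
have V0 n w : (0 <= (V (u n) w)%:E)%E by rewrite lee_fin V_ge0.
have key : ((h 0 x0)%:E * Pstar (~` C) <= (h 0 x0)%:E - (ht 0 x0)%:E * I)%E.
  apply: le_trans (Pstar_le_limn_einf umT FnC) _.
  apply: (@limn_einf_le_cvg _ _
    (fun n => \int[P]_w (V (u n) w)%:E - (ht 0 x0)%:E * W n)%E); last first.
    by apply: cvgeB => //; exact: fin_num_adde_defr.
  have finW : \forall n \near \oo, ((ht 0 x0)%:E * W n)%E \is a fin_num.
    by move: cW; rewrite -(fineK finhI) => /fine_cvgP[].
  apply: filterS2 finW (nbhs_infty_ge m) => n finWn /= mn.
  have unm : u m <= u n by exact: approach_nd.
  have FBn : natural_filtration X (u n) B by exact: natural_filtration_le unm _ FB.
  have FAn : natural_filtration X (u n) (A k (u n)).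
    by apply: A_meas; exact: ltt0.
  have mCn : measurable (B `&` A k (u n)).
    by apply: (mF n); exact: natural_filtrationI.
  have mnC : measurable (~` C) by exact: mF FnC.
  have sub : B `&` A k (u n) `<=` C by apply: setIS; exact: nested_events.
  rewrite leeBrDr// (integral_Pcirc k (u_itv n) FBn) -ge0_integral_setU//.
  - by apply: ge0_subset_integral => //; [exact: measurableU|exact: mV].
  - by apply: mV; exact: measurableU.
  - by apply/disj_setPS => w [nCw /sub].
move: key; rewrite probability_setC; last exact: mOm FC.
have finC : Pstar C \is a fin_num by exact: fin_num_measure (mOm _ _ FC).
rewrite -(fineK finI) -(fineK finC) -EFinB -!EFinM -EFinB !lee_fin.
by rewrite mulrBr mulr1 lerD2l lerN2.
Qed.

Lemma guided_le_conditioned_limit k s B : 0 <= s < T ->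
  natural_filtration X s B ->
  ((ht 0 x0)%:E * \int[Pcirc]_(w in B) (PsiT w * \1_(limit_event k) w)%:E
   <= (h 0 x0)%:E * Pstar (B `&` limit_event k))%E.
Proof.
move=> sT FB; have mB : measurable (B : set Om).
  exact: natural_filtration_pre_terminal sT _ FB.
have mA n : measurable (A k (u n) : set Om).
  apply: (@natural_filtration_pre_terminal _ _ _ _ _ _ (u n) (let0T (u_itv n))).
  by apply: A_meas; exact: ltt0.
have cA : Pstar (B `&` A k (u n)) @[n --> \oo] --> Pstar (B `&` limit_event k).
  have -> : B `&` limit_event k = \bigcap_n (B `&` A k (u n)).
    rewrite limit_eventE; apply/seteqP; split=> [w [Bw Aw] n _|w Aw].
      by split=> //; exact: Aw.
    split=> [|n _]; [by have [] := Aw 0%N Logic.I|].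
    by have [] := Aw n Logic.I.
  apply: nonincreasing_cvg_mu.
  - by rewrite (le_lt_trans (probability_le1 _ _)) ?ltry//; exact: measurableI.
  - by move=> n; exact: measurableI.
  - by apply: bigcapT_measurable => n; exact: measurableI.
  - move=> m n mn; apply/subsetPset; apply: setIS; exact: nested_events.
apply: (cvge_to_ge (cvgeZl _ cA)) => //.
have s_T : s < T by case/andP: sT.
apply: filterS (near_approach t0T' s_T) => n /ltW sn.
apply: guided_le_conditioned_before.
exact: natural_filtration_le sn _ FB.
Qed.

Definition conditioned_weight (k : nat) (t : R) (w : Omega) : R :=
  ht t (X t w) / h t (X t w) * kappa t * \1_(A k t) w.

Hypothesis event_mass : exists ell : nat -> \bar R,
    (forall k,
      induced_expectation L P X x0 h t (conditioned_weight k t)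
      @[t --> T^'-] --> ell k) /\
    ell @ \oo --> Pstar (union_family t0 T A T).

Local Notation AT := (union_family t0 T A T : set Om).

(** The positive part makes this a density everywhere; [PsiT] itself is
    nonnegative only almost surely on [AT] and arbitrary elsewhere. *)
Definition limit_ratio (w : Om) : R := ht 0 x0 / h 0 x0 * Num.max 0 (PsiT w).

Let ratio_gt0 : 0 < ht 0 x0 / h 0 x0. Proof. by rewrite divr_gt0. Qed.

Lemma final_event_measurable : measurable AT.
Proof. by apply: bigcupT_measurable => k; exact: limit_event_measurable. Qed.

Lemma limit_ratio_ge0 w : 0 <= limit_ratio w.
Proof. by rewrite mulr_ge0 ?(ltW ratio_gt0)// le_max lexx. Qed.

Lemma limit_ratio_measurable : measurable_fun [set: Om] limit_ratio.
Proof. by apply: measurable_funM => //; exact: measurable_maxr. Qed.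

Let limit_ratio_PsiT k (B : set Om) : measurable B ->
  ((ht 0 x0 / h 0 x0)%:E *
     \int[Pcirc]_(w in B) (PsiT w * \1_(limit_event k) w)%:E
   = \int[Pcirc]_(w in B `&` limit_event k) (limit_ratio w)%:E)%E.
Proof.
move=> mB; have ml := limit_event_measurable k.
have m1 : measurable_fun [set: Om] (\1_(limit_event k) : Om -> R).
  exact: measurable_indic.
have mmax : measurable_fun [set: Om] (fun w => Num.max 0 (PsiT w)).
  exact: measurable_maxr.
have -> : (\int[Pcirc]_(w in B) (PsiT w * \1_(limit_event k) w)%:E =
    \int[Pcirc]_(w in B) (Num.max 0 (PsiT w) * \1_(limit_event k) w)%:E)%E.
  apply: ae_eq_integral => //.
  - by apply: measurable_funTS; apply/measurable_EFinP; exact: measurable_funM.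
  - by apply: measurable_funTS; apply/measurable_EFinP; exact: measurable_funM.
  - apply: ae_mono PsiT_ge0 => w w0 _; congr EFin; rewrite indicE.
    have [/set_mem /w0 p0|_] := boolP (w \in limit_event k); last first.
      by rewrite !mulr0.
    by rewrite (max_idPr _).
rewrite -ge0_integralZl//; last 3 first.
- by apply: measurable_funTS; apply/measurable_EFinP; exact: measurable_funM.
- by move=> w _; rewrite lee_fin mulr_ge0// le_max lexx.
- by rewrite lee_fin ltW.
rewrite [LHS]integral_set_indic [RHS]integral_set_indic.
apply: eq_integral => w _; rewrite -!EFinM indicI /limit_ratio /=.
by congr EFin; ring.
Qed.

Lemma induced_expectation_weight k n :
  (induced_expectation L P X x0 h (u n) (conditioned_weight k (u n))
  = (ht 0 x0 / h 0 x0)%:E * \int[Pcirc]_w (guided_weight k (u n) w)%:E)%E.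
Proof.
have un := u_itv n; have unT := let0T un.
have FA := A_meas k (ltt0 un).
have mA : measurable (A k (u n)).
  by apply: (natural_filtration_measurable mX _ FA); case/andP: unT => _ /ltW.
rewrite mulrC EFinM -muleA (integral_Pcirc k un (natural_filtrationT (t := u n))).
rewrite setTI -ge0_integralZl//; last 3 first.
- apply: measurable_funTS; apply/measurable_EFinP.
  apply: (measurable_fun_adapted mX _ (V_measurable un)).
  by case/andP: unT => _ /ltW.
- by move=> w _; rewrite lee_fin V_ge0.
- by rewrite lee_fin invr_ge0 ltW.
rewrite [RHS]integral_set_indic /induced_expectation; apply: eq_integral => w _.
rewrite (Dproc_harmonic X x0 w Ah0 unT) -!EFinM; congr EFin.
rewrite /guiding_weight /conditioned_weight.
have hn0 : h (u n) (X (u n) w) != 0 by rewrite gt_eqF// (good_gt0 h_good).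
have h0n0 : h 0 x0 != 0 by rewrite gt_eqF.
by field; apply/andP; split.
Qed.

(** For fixed [k] the limit in [event_mass] is a guided expectation, because
    before [T] the two weights are both integrals of [V] over [A k t]. *)
Lemma limit_mass k (l : \bar R) :
  induced_expectation L P X x0 h t (conditioned_weight k t)
  @[t --> T^'-] --> l ->
  l = (\int[Pcirc]_(w in limit_event k) (limit_ratio w)%:E)%E.
Proof.
move=> cl.
have c1 := cvg_comp _ _ (cvg_approach t0T') cl.
have [_ cI] := cvg_guided_weight k (@measurableT _ Om).
have c2 := cvgeZl (y := (ht 0 x0 / h 0 x0)%:E) erefl cI.
rewrite limit_ratio_PsiT// setTI in c2.
have E : (fun n => (ht 0 x0 / h 0 x0)%:E *
    \int[Pcirc]_w (guided_weight k (u n) w)%:E)%E =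
  (fun n => induced_expectation L P X x0 h (u n) (conditioned_weight k (u n))).
  by apply/funext => n; rewrite induced_expectation_weight.
rewrite E in c2.
exact: cvg_unique c1 c2.
Qed.

(** One inequality holds for every event of [F_s] by comparison before [T];
    equality of the total masses then forces equality for an event and its
    complement together. *)
Lemma conditioned_eq_guided (B : set Om) : measurable B ->
  (Pstar (B `&` AT) = \int[Pcirc]_(w in B `&` AT) (limit_ratio w)%:E)%E.
Proof.
move=> mB; have mAT := final_event_measurable.
have [m mE] := measure_of_density Pcirc limit_ratio_ge0 limit_ratio_measurable.
rewrite -mE.
have cap_cvg (q : {measure set Om -> \bar R}) (C : set Om) : measurable C ->
    q (C `&` limit_event k) @[k --> \oo] --> q (C `&` AT).
  move=> mC; rewrite /AT /union_family setI_bigcupr.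
  apply: nondecreasing_cvg_mu.
  - by move=> k; apply: measurableI => //; exact: limit_event_measurable.
  - rewrite -setI_bigcupr; exact: measurableI.
  - by move=> k l kl; apply/subsetPset; apply: setIS; exact: limit_event_nd.
have m_le s C : 0 <= s < T -> natural_filtration X s C ->
    (m (C `&` AT) <= Pstar (C `&` AT))%E.
  move=> sT FC; have mC : measurable (C : set Om).
    exact: natural_filtration_pre_terminal sT _ FC.
  apply: (lee_cvg_to (cap_cvg m C mC) (cap_cvg Pstar C mC)); apply: nearW => k.
  rewrite mE -limit_ratio_PsiT// mulrC EFinM -muleA.
  have := guided_le_conditioned_limit k sT FC.
  move/(lee_wpmul2l (x := ((h 0 x0)^-1)%:E)).
  rewrite lee_fin invr_ge0 (ltW h00) => /(_ isT) /le_trans; apply.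
  by rewrite muleA -EFinM mulVf ?gt_eqF// mul1e.
have m_total : m AT = Pstar AT.
  have [ell [ellE cell]] := event_mass.
  have ellm : ell = fun k => m (setT `&` limit_event k).
    by apply/funext => k; rewrite setTI mE; exact: limit_mass (ellE k).
  have := cap_cvg m setT measurableT; rewrite setTI -ellm => cm.
  exact: cvg_unique cm cell.
have PAT : Pstar AT \is a fin_num by exact: fin_num_measure.
have m_eq s C : 0 <= s < T -> natural_filtration X s C ->
    m (C `&` AT) = Pstar (C `&` AT).
  move=> sT FC; apply/eqP; rewrite eq_le (m_le s)//=.
  have mC : measurable (C : set Om).
    exact: natural_filtration_pre_terminal sT _ FC.
  have split (q : {measure set Om -> \bar R}) :
      q AT = (q (C `&` AT) + q (~` C `&` AT))%E.
    rewrite -measureU//; last 3 first.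
    - exact: measurableI.
    - by apply: measurableI => //; exact: measurableC.
    - by rewrite setIACA setICr set0I.
    by rewrite -setIUl setUCr setTI.
  have fin1 : Pstar (~` C `&` AT) \is a fin_num.
    by apply: fin_num_measure; apply: measurableI => //; exact: measurableC.
  have : (Pstar (C `&` AT) + Pstar (~` C `&` AT) <=
      m (C `&` AT) + Pstar (~` C `&` AT))%E.
    have -> : (Pstar (C `&` AT) + Pstar (~` C `&` AT) = m AT)%E.
      by rewrite m_total; exact/esym/split.
    rewrite (split m) leeD2l//.
    by apply: (m_le s) => //; exact: natural_filtrationC.
  by rewrite leeD2rE.
apply/esym.
apply: (@measure_unique _ R Om (pre_terminal X T) (fun _ => setT) _ _ _ _
  (mrestr m mAT) (mrestr Pstar mAT)) => //.
- exact: pre_terminalI.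
- move=> _; exists 0; [by rewrite /= in_itv/= T_ge0|exact: natural_filtrationT].
- by rewrite bigcup_const//; exists 0%N.
- by move=> C [s /= sT FC]; apply: m_eq FC; rewrite in_itv in sT.
- by move=> k; rewrite /= /mrestr setTI m_total ltey_eq PAT.
Qed.

Lemma limit_ratio_ae : {ae Pcirc, forall w,
  AT w -> limit_ratio w = ht 0 x0 / h 0 x0 * PsiT w}.
Proof.
apply: ae_mono PsiT_ge0 => w w0 [k _ kw].
by rewrite /limit_ratio (max_idPr _)//; exact: w0 kw.
Qed.

End guided.

(** * Conditioned and guided laws at time [T] *)

Theorem theorem3p3 (R : realType) (T : R) (T_gt0 : 0 < T)
  (S : ptopologicalType) (S_polish : polish_space R S)
  (d : measure_display) (Omega : measurableType d) (P : probability Omega R)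
  (X : R -> Omega -> S) (K : R -> R -> R.-pker (borel S) ~> (borel S))
  (X_markov : markov_process P T X K)
  (x0 : S) (X_start : {ae P, forall w, X 0 w = x0})
  (L : R -> (S -> R) -> (S -> R)) (DL : set (S -> R))
  (DA : set (R -> S -> R))
  (X_L : generated_by L P T X x0 DL)
  (X_A : space_time_generated_by L P T X x0 DL DA)
  (h ht : R -> S -> R)
  (h_good : forall u, 0 <= u < T -> good L P X x0 DA u h)
  (ht_good : forall u, 0 <= u < T -> good L P X x0 DA u ht)
  (Ah0 : forall t x, 0 < t < T -> space_time_generator L h t x = 0)
  (Dht_gt0 : forall t, 0 <= t < T ->
    {ae P, forall w, 0 < Dproc L X x0 ht t w})
  (Pstar Pcirc : probability (g_sigma_algebraType (pre_terminal X T)) R)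
  (Pstar_h : is_induced_law L P x0 h Pstar)
  (Pcirc_ht : is_induced_law L P x0 ht Pcirc)
  (t0 : R) (t0_T : 0 <= t0 < T)
  (kappa : R -> R)
  (kappa_gt0 : forall t, t0 <= t < T -> 0 < kappa t)
  (kappa_cont : {within `[t0, T[, continuous kappa})
  (A : nat -> R -> set Omega)
  (A_meas : forall k t, t0 <= t < T -> natural_filtration X t (A k t))
  (hyp_a : forall k s t, t0 <= s -> s <= t -> t <= T ->
    closed_family t0 T A k t `<=` closed_family t0 T A k.+1 t /\
    closed_family t0 T A k t `<=` closed_family t0 T A k s)
  (nu : {measure set (borel S) -> \bar R}) (p : R -> S -> R -> S -> R)
  (hyp_b_density : transition_density T K nu p)
  (hyp_b_limit : forall s x, 0 <= s < T ->
    hsharp nu p kappa ht t s x @[t --> T^'-] --> (h s x)%:E)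
  (hyp_c : forall s t, t0 <= s -> s < t -> t < T ->
    exists C : R,
      {ae P, forall w, (hsharp nu p kappa ht t s (X s w) <= C%:E)%E})
  (hyp_d : exists ell : nat -> \bar R,
    (forall k,
      induced_expectation L P X x0 h t (fun w =>
        ht t (X t w) / h t (X t w) * kappa t * \1_(A k t) w)
      @[t --> T^'-] --> ell k) /\
    ell @ \oo --> Pstar (union_family t0 T A T))
  (hyp_e : forall k, exists C : R,
    {ae Pcirc, forall w, forall t, t0 <= t < T ->
      Psi L X ht t w * kappa t * \1_(A k t) w <= C})
  (PsiT : g_sigma_algebraType (pre_terminal X T) -> R)
  (PsiT_meas : measurable_fun [set: _] PsiT)
  (PsiT_lim : forall k, {ae Pcirc, forall w,
    (Psi L X ht t w * kappa t * \1_(A k t) w) @[t --> T^'-] -->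
      PsiT w * \1_(closed_family t0 T A k T) w}) :
  let AT := union_family t0 T A T in
  (forall f : g_sigma_algebraType (pre_terminal X T) -> R,
    measurable_fun [set: _] f ->
    (\int[Pstar]_w (f w * \1_AT w)%:E =
     \int[Pcirc]_w (f w * (ht 0 x0 / h 0 x0 * PsiT w) * \1_AT w)%:E)%E) /\
  (Pcirc AT = 1%E -> Pstar AT = 1%E ->
    [/\ Pstar `<< Pcirc,
        ae_eq Pcirc [set: _]
          (Radon_Nikodym (charge_of_finite_measure Pstar) Pcirc)
          (fun w => (ht 0 x0 / h 0 x0 * PsiT w)%:E)
      & {ae Pcirc, forall w, 0 < PsiT w} -> Pcirc `<< Pstar]).
Proof.
have mAT := final_event_measurable t0_T A_meas hyp_a.
have mPsi : measurable_fun [set: g_sigma_algebraType (pre_terminal X T)]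
    (fun w => ht 0 x0 / h 0 x0 * PsiT w) by exact: measurable_funM.
have rho0 := limit_ratio_ge0 h_good ht_good t0_T PsiT.
have mrho := limit_ratio_measurable x0 h ht PsiT_meas.
have rhoE := limit_ratio_ae x0 h t0_T kappa_gt0 PsiT_lim.
have lawE := conditioned_eq_guided X_markov X_start X_L X_A h_good ht_good Ah0
  Pstar_h Pcirc_ht t0_T kappa_gt0 A_meas hyp_a hyp_b_density hyp_b_limit
  PsiT_meas PsiT_lim hyp_e hyp_d.
split=> [f mf|circ1 star1].
  exact: (integral_change_of_law mAT mPsi rho0 mrho rhoE lawE mf).
split.
- exact: (dominated_change_of_law mAT mPsi mrho rhoE lawE circ1 star1).
- exact: (Radon_Nikodym_change_of_law mAT mPsi mrho rhoE lawE circ1 star1).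
- move=> PsiT_gt0.
  apply: (equivalent_change_of_law mAT rho0 mrho rhoE lawE circ1 star1).
  apply: ae_mono PsiT_gt0 => w w0.
  by rewrite mulr_gt0// divr_gt0//;
    [apply: (good_gt0 ht_good)|apply: (good_gt0 h_good)];
    rewrite lexx.
Qed.
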